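(* Let $K$ be a fixed matrix in $\mathbb{C}^{n\times m}$ and let $t=p/q$ be any rational number in $[0,1]$. Then the convex set $$\left\{(A,B,\tau)\in \mathbf{H}^n_{++}\times\mathbf{H}^m_{++}\times\mathbb{R} \;:\; \operatorname{tr}\left[K^*A^{1-t}KB^t\right]\geq \tau\right\}$$ has a semidefinite programming representation with at most $2\lfloor \log_2 q\rfloor+3$ linear matrix inequalities of size at most $2nm\times 2nm$.
   Context: $\mathbf{H}^n$ denotes the space of $n\times n$ complex Hermitian matrices, $\mathbf{H}^n_{++}$ the cone of $n\times n$ Hermitian (strictly) positive definite matrices; $K^*$ is the conjugate transpose; $X\succeq 0$ means $X$ is positive semidefinite. Here $p,q$ are integers with $q\ge 1$. A linear matrix inequality (LMI) of size $N$ (or $N\times N$) in real variables $y_1,\dots,y_k$ is a condition $A_0+y_1A_1+\dots+y_kA_k\succeq 0$ with $A_0,\dots,A_k\in\mathbf{H}^N$ fixed. A convex set has a semidefinite programming (SDP) representation if it can be expressed using LMIs, where auxiliary (lifting) variables are allowed: a point $x$ is in the set if and only if there exist auxiliary variables $y$ such that $(x,y)$ satisfies finitely many LMIs. The size of the representation is recorded by the number of LMIs of each size. Convention: matrix variables $A,B$ are understood to be restricted to the positive definite cones; this domain restriction is implicit in the SDP representations and is not counted among the LMIs. *)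

(* Defs.v *)
From HB Require Import structures.
From mathcomp Require Import all_boot all_order all_algebra.
From mathcomp Require Import spectral sesquilinear complex.
From mathcomp Require Import boolp classical_sets reals exp.

Set Implicit Arguments.
Unset Strict Implicit.
Unset Printing Implicit Defensive.

Import Order.TTheory GRing.Theory Num.Theory.

Local Open Scope classical_set_scope.
Local Open Scope sesquilinear_scope.
Local Open Scope complex_scope.
Local Open Scope ring_scope.

Section Hermitian.
Context {R : realType}.

(* In the order of [R[i]], [0 <= z] says that [z] is real and nonnegative. *)
Definition posdefmx (n : nat) (A : 'M[R[i]]_n) : Prop :=
  A \is hermsymmx /\
  forall v : 'cV[R[i]]_n, v != 0 -> 0 < (v ^t* *m A *m v) 0 0.

Definition possemidefmx (n : nat) (A : 'M[R[i]]_n) : Prop :=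
  A \is hermsymmx /\
  forall v : 'cV[R[i]]_n, 0 <= (v ^t* *m A *m v) 0 0.

(* The power is only meaningful for a positive definite [A]. There
   [A = invmx P *m diag_mx d *m P], with [P := spectralmx A] unitary and
   [d := spectral_diag A] the positive eigenvalues of [A]. *)
Definition mxpow (n : nat) (A : 'M[R[i]]_n) (s : R) : 'M[R[i]]_n :=
  invmx (spectralmx A)
  *m diag_mx (map_mx (fun z : R[i] => (complex.Re z `^ s)%:C) (spectral_diag A))
  *m spectralmx A.

(* On Hermitian matrices this is a linear bijection onto real row vectors:
   the entries on and above the diagonal determine the real parts, and the
   entries below it the imaginary parts. *)
Definition herm_coord (n : nat) (A : 'M[R[i]]_n) : 'rV[R]_(n * n) :=
  mxvec (\matrix_(i, j)
    if (i <= j)%N then complex.Re (A i j) else complex.Im (A i j)).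

End Hermitian.

Section SDP.
Context {R : realType}.

Record lmi (k : nat) := LMI {
  lmi_size : nat;
  lmi_const : 'M[R[i]]_lmi_size;
  lmi_coef : 'I_k -> 'M[R[i]]_lmi_size;
  lmi_const_herm : lmi_const \is hermsymmx;
  lmi_coef_herm : forall i, lmi_coef i \is hermsymmx }.

Definition lmi_holds (k : nat) (L : lmi k) (y : 'rV[R]_k) : Prop :=
  possemidefmx (lmi_const L + \sum_(i < k) (y 0 i)%:C *: lmi_coef L i).

(* [S] is represented, inside the domain [D], by at most [r] LMIs of size at
   most [N] in the real coordinates [coord x] of the point [x] and in [l]
   lifting variables. Membership in [D] is not counted among the LMIs. *)
Definition has_sdp_representation (T : Type) (k : nat) (coord : T -> 'rV[R]_k)
    (D S : set T) (r N : nat) : Prop :=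
  exists (s l : nat) (L : 'I_s -> lmi (k + l)),
    [/\ (s <= r)%N,
        forall i, (lmi_size (L i) <= N)%N &
        forall x, S x <->
          D x /\ exists y : 'rV[R]_l, forall i, lmi_holds (L i) (row_mx (coord x) y)].

End SDP.

Section Lieb.
Context {R : realType}.

Definition lieb_space (n m : nat) : Type := ('M[R[i]]_n * 'M[R[i]]_m * R)%type.

(* Matrices over [R[i]] carry no [lmodType R] structure in the library, so
   that [convex_set] does not apply to subsets of [lieb_space n m]. *)
Definition lieb_convex (n m : nat) (S : set (lieb_space n m)) : Prop :=
  forall (x y : lieb_space n m) (l : R), 0 <= l -> l <= 1 -> S x -> S y ->
    S (l%:C *: x.1.1 + (1 - l)%:C *: y.1.1,
       l%:C *: x.1.2 + (1 - l)%:C *: y.1.2,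
       l * x.2 + (1 - l) * y.2).

Definition lieb_coord (n m : nat) (x : lieb_space n m) :
    'rV[R]_(n * n + m * m + 1) :=
  row_mx (row_mx (herm_coord x.1.1) (herm_coord x.1.2)) (const_mx x.2).

Definition lieb_domain (n m : nat) : set (lieb_space n m) :=
  [set x | posdefmx x.1.1 /\ posdefmx x.1.2].

Definition lieb_hypograph (n m : nat) (K : 'M[R[i]]_(n, m)) (t : R) :
    set (lieb_space n m) :=
  [set x | let: (A, B, tau) := x in
    [/\ posdefmx A, posdefmx B &
        tau%:C <= \tr (K ^t* *m mxpow A (1 - t) *m K *m mxpow B t)]].

End Lieb.

(* Main.v *)
(* Left multiplication by A and right multiplication by B commute as operators on
   n x m matrices, so they are simultaneously diagonalized, with eigenvalues a_i and
   b_i, and the trace function is the quadratic form of diag(a_i^(1-t) b_i^t) at K.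
   The weighted geometric mean is built from the blocks [[X, Z], [Z, Y]] >= 0.  With
   2^l <= q < 2^(l+1) and, up to exchanging A and B, p < 2^l:
   - l blocks force W_l <= Z #_r A for the dyadic r = q/2^l - 1;
   - the block [[B, Z], [Z, W_l]] closes the loop and forces Z <= A #_(2^l/q) B;
   - l further blocks force V_l <= A #_(p/2^l) Z <= A #_(p/q) B.
   The lifting variables need not commute with A and B, but every upper bound does, so
   the only matrix inequality needed is: [[X, Z], [Z, Y]] >= 0 with X <= diag a and
   Y <= diag b implies Z <= diag (sqrt (a b)).  For the loop, a bound Z <= c^2 G improves
   to Z <= c G as long as c >= 1, hence Z <= G. *)
Require Import Defs.
From mathcomp Require Import all_boot all_order all_algebra.
From mathcomp Require Import spectral sesquilinear complex.
From mathcomp Require Import boolp classical_sets reals exp.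
From mathcomp Require Import ring lra zify.

Import Order.TTheory GRing.Theory Num.Theory.

Set Implicit Arguments.
Unset Strict Implicit.
Unset Printing Implicit Defensive.

Local Open Scope sesquilinear_scope.
Local Open Scope complex_scope.
Local Open Scope ring_scope.

(** * Hermitian forms on row vectors and the block inequality *)

Section Forms.
Context {C : numClosedFieldType}.
Implicit Types (N : nat).

(** Rows rather than columns, because [mxvec] and [lin_mulmx] act on rows. *)
Definition hform N (M : 'M[C]_N) (u v : 'rV[C]_N) : C := (u *m M *m v ^t*) 0 0.

Definition wsum N (a x : 'rV[C]_N) : C := \sum_i a 0 i * `|x 0 i| ^+ 2.

Lemma adjmxM m n p (A : 'M[C]_(m, n)) (B : 'M[C]_(n, p)) :
  (A *m B) ^t* = B ^t* *m A ^t*.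
Proof. by rewrite trmx_mul map_mxM. Qed.

Lemma adjmxK m n (A : 'M[C]_(m, n)) : (A ^t*) ^t* = A.
Proof. by apply/matrixP => i j; rewrite !mxE conjCK. Qed.

Lemma hermmxP N (A : 'M[C]_N) : reflect (A ^t* = A) (A \is hermsymmx).
Proof.
by rewrite is_hermitianmxE expr0 scale1r eq_sym; exact: eqP.
Qed.

Lemma hformC N (M : 'M[C]_N) u v : M \is hermsymmx -> hform M v u = (hform M u v)^*.
Proof.
move=> /hermmxP hM; have <- : ((u *m M *m v ^t*) ^t*) 0 0 = (hform M u v)^* by rewrite mxE mxE.
by rewrite !adjmxM adjmxK hM mulmxA.
Qed.

Lemma hform_diag N (d : 'rV[C]_N) u : hform (diag_mx d) u u = wsum d u.
Proof.
rewrite /hform /wsum mul_mx_diag mxE; apply: eq_bigr => i _.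
by rewrite !mxE normCK mulrA [d 0 i * _]mulrC.
Qed.

Lemma hformD N (M M' : 'M[C]_N) u v : hform (M + M') u v = hform M u v + hform M' u v.
Proof. by rewrite /hform mulmxDr mulmxDl mxE. Qed.

Lemma hformN N (M : 'M[C]_N) u v : hform (- M) u v = - hform M u v.
Proof. by rewrite /hform mulmxN mulNmx mxE. Qed.

Lemma hformZ N c (M : 'M[C]_N) u v : hform (c *: M) u v = c * hform M u v.
Proof. by rewrite /hform -scalemxAr -scalemxAl mxE. Qed.

Lemma hform_conj N (M U : 'M[C]_N) u v :
  hform (U *m M *m U ^t*) u v = hform M (u *m U) (v *m U).
Proof. by rewrite /hform adjmxM !mulmxA. Qed.

Lemma wsum_gt0 N (a x : 'rV[C]_N) : (forall i, 0 < a 0 i) -> x != 0 -> 0 < wsum a x.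
Proof.
move=> a0 /rV0Pn[i xi]; rewrite /wsum (bigD1 i) //=; apply: ltr_pwDl.
  by rewrite mulr_gt0 // exprn_gt0 // normr_gt0.
by apply: sumr_ge0 => j _; rewrite mulr_ge0 ?exprn_ge0 // ltW.
Qed.

Lemma row_unitary_neq0 N (P : 'M[C]_N) i : P \is unitarymx -> row i P != 0.
Proof.
move=> /unitarymxP/matrixP/(_ i i); rewrite !mxE eqxx => h; apply/eqP => /rowP r0.
move: h; rewrite big1 => [|j _]; first by move/eqP; rewrite eq_sym oner_eq0.
by have := r0 j; rewrite !mxE => ->; rewrite mul0r.
Qed.

(** In the eigenbasis the form is a sum of eigenvalues weighted by squared moduli, and the rows of
    [spectralmx H] are left eigenvectors. The hypothesis speaks of eigenvectors so that a violation
    can be refuted at a single vector. *)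
Lemma herm_form_le0 N (H : 'M[C]_N) : H \is hermsymmx ->
  (forall (v : 'rV[C]_N) l, v != 0 -> l \is Num.real -> v *m H = l *: v -> l <= 0) ->
  forall u, hform H u u <= 0.
Proof.
move=> hH neg u.
have /orthomx_spectralP E : H \is normalmx.
  by apply/normalmxP; move/hermmxP: hH => ->.
have U := spectral_unitarymx H.
rewrite E invmx_unitary //.
rewrite -{2}[spectralmx H]adjmxK hform_conj hform_diag.
apply: sumr_le0 => i _; rewrite mulr_le0_ge0 ?exprn_ge0 //.
apply: (neg (row i (spectralmx H))).
- exact: row_unitary_neq0.
- have /mxOverP := hermitian_spectral_diag_real hH; exact.
- rewrite {2}E -row_mul !mulmxA mulmxV ?unitarymx_unit // mul1mx.
  by apply/rowP => j; rewrite mul_diag_mx !mxE.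
Qed.

(** The Loewner inequality Z <= U diag(g) U^*. *)
Definition dominated N (U Z : 'M[C]_N) (g : 'rV[C]_N) :=
  forall u, hform Z u u <= wsum g (u *m U).

Definition block_nonneg N (X Z Y : 'M[C]_N) :=
  forall u v, 0 <= hform X u u + hform Z u v + hform Z v u + hform Y v v.

(* If Z <= diag g fails in the basis U, then U^* Z U - diag g has an eigenvector v
   with eigenvalue l > 0, at which the block is tested. *)
Lemma block_dominated N (U X Z Y : 'M[C]_N) (a b g : 'rV[C]_N) :
  U \is unitarymx -> Z \is hermsymmx ->
  (forall i, 0 < a 0 i) -> (forall i, 0 < g 0 i) ->
  (forall i, g 0 i ^+ 2 = a 0 i * b 0 i) ->
  dominated U X a -> dominated U Y b -> block_nonneg X Z Y ->
  dominated U Z g.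
Proof.
move=> Uu hZ a0 g0 gab dX dY XZY.
have UUt : U *m U ^t* = 1%:M by exact/unitarymxP.
have UtU : U ^t* *m U = 1%:M.
  exact: mulmx1C.
pose W := U ^t* *m Z *m U.
have hW : W ^t* = W by rewrite /W !adjmxM adjmxK (hermmxP _ hZ) mulmxA.
pose H := W - diag_mx g.
have hdiag (d : 'rV[C]_N) : (forall i, 0 < d 0 i) -> (diag_mx d) ^t* = diag_mx d.
  move=> d0; apply/matrixP => i j; rewrite !mxE eq_sym rmorphMn /=.
  by case: eqP => // ->; rewrite geC0_conj // ltW.
have hH : H \is hermsymmx.
  by apply/hermmxP; rewrite /H linearB map_mxB hW hdiag.
suff Hle : forall x, hform H x x <= 0.
  move=> u; have := Hle (u *m U); rewrite hformD hformN hform_diag subr_le0.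
  by rewrite -hform_conj /W !mulmxA UUt mul1mx -mulmxA UUt mulmx1.
apply: herm_form_le0 => // v l v0 lr vH.
rewrite real_leNgt //; apply/negP => l0.
(* The block form at (v S, - v), S = diag (g / a), is at most - 2 l |v sqrt S|^2 < 0. *)
pose s : 'rV[C]_N := \row_i (g 0 i / a 0 i).
have s0 i : 0 < s 0 i by rewrite mxE divr_gt0.
have vW : v *m W = l *: v + v *m diag_mx g by rewrite -vH /H mulmxBr subrK.
have h0 := XZY (v *m diag_mx s *m U ^t*) (- (v *m U ^t*)).
(* As a (g / a)^2 = g^2 / a = b, each diagonal term is at most [wsum b v]; these two bounds cancel
   against g s = b in the cross terms. *)
have hX : hform X (v *m diag_mx s *m U ^t*) (v *m diag_mx s *m U ^t*)
   <= wsum b v.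
  apply: le_trans (dX _) _; rewrite -mulmxA UtU mulmx1.
  rewrite le_eqVlt; apply/orP; left; apply/eqP/eq_bigr => i _.
  rewrite mul_mx_diag !mxE normrM exprMn.
  have ai : a 0 i != 0 by rewrite gt_eqF.
  rewrite (@ger0_norm _ (g 0 i / a 0 i)) ?divr_ge0 ?ltW //.
  by rewrite expr_div_n gab; field.
have hY : hform Y (- (v *m U ^t*)) (- (v *m U ^t*)) <= wsum b v.
  apply: le_trans (dY _) _; rewrite mulNmx -mulmxA UtU mulmx1.
  by rewrite le_eqVlt; apply/orP; left; apply/eqP/eq_bigr => i _; rewrite mxE normrN.
have hZ2 : hform Z (- (v *m U ^t*)) (v *m diag_mx s *m U ^t*) = - (l * wsum s v + wsum b v).
  rewrite /hform !adjmxM adjmxK !mulNmx mxE; congr (- _).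
  rewrite (_ : v *m U ^t* *m Z *m _ = v *m W *m (v *m diag_mx s)^t*); last first.
    by rewrite adjmxM /W !mulmxA.
  rewrite vW mulmxDl -scalemxAl mxE [in X in X + _]mxE; congr (_ * _ + _).
    rewrite -hform_diag /hform adjmxM hdiag // mulmxA //.
  rewrite mul_mx_diag adjmxM hdiag // mxE; apply: eq_bigr => i _.
  rewrite mul_diag_mx !mxE normCK.
  have ai : a 0 i != 0 by rewrite gt_eqF.
  have -> : b 0 i = g 0 i ^+ 2 / a 0 i by rewrite gab; field.
  by field.
(* The two cross terms are conjugate to each other, hence equal once one is known to be real. *)
have rl : l * wsum s v + wsum b v \is Num.real.
  have b0 i : 0 <= b 0 i.
    by rewrite -(pmulr_rge0 _ (a0 i)) -gab exprn_ge0 // ltW.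
  apply: rpredD; first by apply: rpredM => //; apply: gtr0_real; apply: wsum_gt0.
  by apply: ger0_real; apply: sumr_ge0 => i _; rewrite mulr_ge0 ?exprn_ge0.
have hZ1 : hform Z (v *m diag_mx s *m U ^t*) (- (v *m U ^t*)) = - (l * wsum s v + wsum b v).
  by rewrite hformC // hZ2; apply/CrealP; rewrite rpredN.
have h1 := le_trans h0 (lerD (lerD (lerD hX (lexx _)) (lexx _)) hY).
move: h1; rewrite hZ1 hZ2.
rewrite (_ : _ + _ = - (l * wsum s v *+ 2)); last by ring.
by rewrite oppr_ge0 lt_geF // pmulrn_lgt0 // mulr_gt0 // wsum_gt0.
Qed.

Lemma wsumZ N c (a x : 'rV[C]_N) : wsum (c *: a) x = c * wsum a x.
Proof. by rewrite /wsum mulr_sumr; apply: eq_bigr => i _; rewrite mxE mulrA. Qed.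

Lemma ler_wsum N (a b x : 'rV[C]_N) : (forall i, a 0 i <= b 0 i) -> wsum a x <= wsum b x.
Proof. by move=> ab; apply: ler_sum => i _; rewrite ler_wpM2r ?exprn_ge0. Qed.

(** Supplies the crude initial bound from which the loop argument starts improving. *)
Lemma dominated_bound N (U Z : 'M[C]_N) (g : 'rV[C]_N) :
  U \is unitarymx -> Z \is hermsymmx -> (forall i, 0 < g 0 i) ->
  exists2 c : C, 0 <= c & dominated U Z (c *: g).
Proof.
move=> Uu hZ g0.
pose W := U ^t* *m Z *m U.
have UUt : U *m U ^t* = 1%:M by exact/unitarymxP.
(* Since |x_i| |x_j| <= |x_i|^2 + |x_j|^2, the form of W is at most the sum of k_i |x_i|^2; c is
   then chosen so that k_i <= c g_i for every i. *)
pose k i := \sum_j (`|W i j| + `|W j i|).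
have k0 i : 0 <= k i by apply: sumr_ge0 => j _; rewrite addr_ge0.
pose c := \sum_i (g 0 i)^-1 * k i.
have kc i : k i <= c * g 0 i.
  rewrite -ler_pdivrMr // /c (bigD1 i) //= [k i / _]mulrC lerDl.
  by apply: sumr_ge0 => j _; rewrite mulr_ge0 // invr_ge0 ltW.
have c0 : 0 <= c.
  by rewrite /c; apply: sumr_ge0 => i _; rewrite mulr_ge0 // invr_ge0 ltW.
exists c => // u; set x := u *m U.
have -> : hform Z u u = hform W x x.
  by rewrite -hform_conj /W !mulmxA UUt mul1mx -mulmxA UUt mulmx1.
have rW : hform W x x \is Num.real.
  apply/CrealP; rewrite -hformC //.
  by apply/hermmxP; rewrite /W !adjmxM adjmxK (hermmxP _ hZ) mulmxA.
apply: le_trans (real_ler_norm rW) _.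
apply: (@le_trans _ _ (\sum_i k i * `|x 0 i| ^+ 2)); last first.
  by apply: ler_sum => i _; rewrite [(c *: g) 0 i]mxE ler_wpM2r ?exprn_ge0.
apply: (@le_trans _ _ (\sum_j \sum_i `|W i j| * (`|x 0 i| ^+ 2 + `|x 0 j| ^+ 2))).
  rewrite /hform mxE; apply: le_trans (ler_norm_sum _ _ _) _; apply: ler_sum => j _.
  rewrite normrM [(x ^t*) j 0]mxE [x^T j 0]mxE norm_conjC [(x *m W) 0 j]mxE.
  apply: (@le_trans _ _ (\sum_i `|x 0 i| * `|W i j| * `|x 0 j|)).
    rewrite -mulr_suml ler_wpM2r //; apply: le_trans (ler_norm_sum _ _ _) _.
    by apply: ler_sum => i _; rewrite normrM.
  apply: ler_sum => i _; rewrite mulrAC mulrC ler_wpM2l //.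
  have r y : `|y| \is @Num.real C by exact: normr_real.
  rewrite -subr_ge0
    (_ : _ - _ = (`|x 0 i| - `|x 0 j|) ^+ 2 + `|x 0 i| * `|x 0 j|); last by ring.
  by rewrite addr_ge0 ?real_exprn_even_ge0 ?rpredB // mulr_ge0.
rewrite (eq_bigr (fun j => \sum_i `|W i j| * `|x 0 i| ^+ 2 + \sum_i `|W i j| * `|x 0 j| ^+ 2)).
  rewrite big_split /= exchange_big /= -big_split /=; apply: ler_sum => i _.
  by rewrite -!mulr_suml -mulrDl /k big_split.
by move=> j _; rewrite -big_split; apply: eq_bigr => i _; rewrite mulrDr.
Qed.
End Forms.

(** The bound of [block_dominated] is attained: in the common basis coordinate i contributes |a_i
    x_i + g_i y_i|^2 / a_i. *)
Lemma block_nonneg_diag (C : numClosedFieldType) N (U X Y : 'M[C]_N) (a b g : 'rV[C]_N) :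
  (forall i, 0 < a 0 i) -> (forall i, 0 < g 0 i) ->
  (forall i, g 0 i ^+ 2 = a 0 i * b 0 i) ->
  (forall u, hform X u u = wsum a (u *m U)) ->
  (forall u, hform Y u u = wsum b (u *m U)) ->
  block_nonneg X (U *m diag_mx g *m U ^t*) Y.
Proof.
move=> a0 g0 gab fX fY u v; rewrite fX fY !hform_conj.
move: (u *m U) (v *m U) => x y.
have hg x' y' : hform (diag_mx g) x' y' = \sum_i g 0 i * x' 0 i * (y' 0 i)^*.
  rewrite /hform mxE; apply: eq_bigr => i _; rewrite mul_mx_diag !mxE.
  by rewrite [x' 0 i * _]mulrC.
rewrite !hg /wsum -!big_split /=; apply: sumr_ge0 => i _.
have ai : a 0 i != 0 by rewrite gt_eqF.
have -> : b 0 i = g 0 i ^+ 2 / a 0 i by rewrite gab; field.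
rewrite (_ : _ + _ = `|a 0 i * x 0 i + g 0 i * y 0 i| ^+ 2 / a 0 i).
  by rewrite divr_ge0 ?exprn_ge0 // ltW.
rewrite !normCK !rmorphD !rmorphM /= (geC0_conj (ltW (a0 i))) (geC0_conj (ltW (g0 i))).
by field.
Qed.

(** * Weighted geometric means of vectors, dyadic exponents and a limit argument *)

Lemma le_halving (R : archiRealFieldType) (x y d : R) :
  (forall k, x <= y + d / 2 ^+ k) -> x <= y.
Proof.
move=> h; rewrite leNgt; apply/negP => yx.
pose k := Num.bound `|d / (x - y)|.
have xy : 0 < x - y by rewrite subr_gt0.
have dk : d / (x - y) < 2 ^+ k.
  apply: le_lt_trans (ler_norm _) _.
  apply: lt_trans (archi_boundP (normr_ge0 _)) _.
  by rewrite -natrX ltr_nat ltn_expl.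
have k2 : 0 < 2 ^+ k :> R by rewrite exprn_gt0.
have := h k; rewrite -lerBlDl ler_pdivlMr //.
by move: dk; rewrite ltr_pdivrMr // mulrC => dk; rewrite leNgt dk.
Qed.

Section Weighted.
Context {R : realType} (N : nat).
Implicit Types (a b : 'rV[R]_N) (th : R).

Definition wgm a b th : 'rV[R[i]]_N :=
  \row_i (a 0 i `^ (1 - th) * b 0 i `^ th)%:C.

Lemma wgm_gt0 a b th i : (forall i, 0 < a 0 i) -> (forall i, 0 < b 0 i) ->
  0 < wgm a b th 0 i.
Proof. by move=> a0 b0; rewrite mxE ltcR mulr_gt0 ?powR_gt0. Qed.

Lemma wgmC a b th : wgm a b th = wgm b a (1 - th).
Proof. by apply/rowP => i; rewrite !mxE subKr mulrC. Qed.

(** Averaging exponents is taking geometric means; this yields the condition g^2 = a b required of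
    each block. *)
Lemma wgm_sqr a b s t th i : (forall i, 0 < a 0 i) -> (forall i, 0 < b 0 i) ->
  th *+ 2 = s + t ->
  wgm a b th 0 i ^+ 2 = wgm a b s 0 i * wgm a b t 0 i.
Proof.
move=> a0 b0 h; rewrite !mxE -rmorphXn -rmorphM /=; congr (_%:C).
have H (x r r1 r2 : R) : 0 < x -> r *+ 2 = r1 + r2 -> (x `^ r) ^+ 2 = x `^ r1 * x `^ r2.
  move=> x0 e; rewrite -powRD; last by rewrite (gt_eqF x0) implybT.
  by rewrite -e mulr2n powRD ?expr2 // (gt_eqF x0) implybT.
rewrite exprMn (H (b 0 i) _ s t) //.
rewrite (H (a 0 i) _ (1 - s) (1 - t)) //; last by rewrite mulrnBl h; ring.
by ring.
Qed.

End Weighted.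

Definition bit (s k : nat) : bool := odd (s %/ 2 ^ k).
(* dyadic s k is 0.d_(k-1) ... d_0 in base 2, where d_j = bit s j: prefixing a bit
   amounts to averaging with that bit, that is, to one more block. *)
Definition dyadic (R : realType) (s k : nat) : R := (s %% 2 ^ k)%N%:R / 2 ^+ k.

Lemma dyadic0 (R : realType) s : dyadic R s 0 = 0.
Proof. by rewrite /dyadic expn0 modn1 mul0r. Qed.

Lemma dyadicS (R : realType) s k : dyadic R s k.+1 *+ 2 = (bit s k)%:R + dyadic R s k.
Proof.
have E : (s %% 2 ^ k.+1 = bit s k * 2 ^ k + s %% 2 ^ k)%N.
  rewrite {1}(divn_eq s (2 ^ k)) -{1}(odd_double_half (s %/ 2 ^ k)) -/(bit s k).
  rewrite mulnDl -muln2 -mulnA -expnS addnAC addnC modnMDl modn_small //.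
  rewrite expnS mul2n -addnn.
  have /(ltn_pmod s) : (0 < 2 ^ k)%N by rewrite expn_gt0.
   case: (bit s k) => /=; lia.
rewrite /dyadic E natrD natrM natrX exprS; rewrite -mulr_natr.
have : 2 ^+ k != 0 :> R by rewrite expf_neq0 // pnatr_eq0.
move: (2 ^+ k) => d d0; by field.
Qed.

Lemma dyadic_small (R : realType) s k : (s < 2 ^ k)%N -> dyadic R s k = s%:R / 2 ^+ k.
Proof. by move=> h; rewrite /dyadic modn_small. Qed.

Lemma dominatedW (C : numClosedFieldType) N (U Z : 'M[C]_N) (a b : 'rV[C]_N) :
  (forall i, a 0 i <= b 0 i) -> dominated U Z a -> dominated U Z b.
Proof. by move=> ab h u; apply: le_trans (h u) (ler_wsum _ ab). Qed.

(** Since 1 + d <= (1 + d / 2)^2, [step] turns the factor 1 + d into 1 + d / 2. Iterating from the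
    crude bound, the excess over 1 is halved each time and vanishes in the limit. *)
Lemma dominated_fixpoint (R : realType) N (U Z : 'M[R[i]]_N) (g : 'rV[R[i]]_N) :
  U \is unitarymx -> Z \is hermsymmx -> (forall i, 0 < g 0 i) ->
  (forall c : R[i], 1 <= c -> dominated U Z (c ^+ 2 *: g) -> dominated U Z (c *: g)) ->
  dominated U Z g.
Proof.
move=> Uu hZ g0 step.
have [c c0 hc] := dominated_bound Uu hZ g0.
have cR : (complex.Re c)%:C = c by apply: RRe_real; apply: ger0_real.
set e := complex.Re c in cR.
have e0 : 0 <= e by rewrite -ler0c cR.
have hk k : dominated U Z ((1 + e / 2 ^+ k)%:C *: g).
  elim: k => [|k IH].
    apply: dominatedW hc => i; rewrite !mxE ler_pM2r // expr0 divr1 -[leLHS]cR lecR; lra.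
  have ek : 0 <= e / 2 ^+ k by rewrite divr_ge0 ?exprn_ge0.
  have e2 : e / 2 ^+ k.+1 = e / 2 ^+ k / 2.
    have : 2 ^+ k != 0 :> R by rewrite expf_neq0 // pnatr_eq0.
    by rewrite exprS; move: (2 ^+ k) => d d0; field.
  rewrite e2; apply: step; first by rewrite (lecR 1); lra.
  apply: dominatedW IH => i; rewrite !mxE ler_pM2r //.
  rewrite [leRHS](_ : _ = ((1 + e / 2 ^+ k / 2) ^+ 2)%:C); last by rewrite rmorphXn.
  rewrite lecR.
  by move: (e / _) ek => f f0; nra.
move=> u; have w0 : 0 <= wsum g (u *m U).
  by apply: sumr_ge0 => i _; rewrite mulr_ge0 ?exprn_ge0 // ltW.
(* Both sides are real, so the limit can be taken in the Archimedean field [R]. *)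
have hr : hform Z u u \is Num.real by apply/CrealP; rewrite -hformC.
rewrite -(RRe_real hr) -(RRe_real (ger0_real w0)) lecR.
apply: (@le_halving _ _ _ (e * complex.Re (wsum g (u *m U)))) => k.
have := hk k u; rewrite wsumZ -{1}(RRe_real hr) -{1}(RRe_real (ger0_real w0)) -rmorphM lecR.
by move=> h; apply: le_trans h _; rewrite mulrDl mul1r mulrAC.
Qed.

(** * Chains of blocks driven by binary digits *)

Section Chain.
Context {R : realType} (N : nat).
Variables (U : 'M[R[i]]_N) (a b : 'rV[R]_N).
Hypotheses (Uu : U \is unitarymx) (a0 : forall i, 0 < a 0 i) (b0 : forall i, 0 < b 0 i).

(** Each block averages the current exponent with [tau] or [sg] according to the next digit, which
    is the recursion [dyadicS]. A factor c common to both ends passes through every mean unchanged;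
    the loop needs this. *)
Lemma chain_dominated (X0 X1 : 'M[R[i]]_N) (W : nat -> 'M[R[i]]_N) c sg tau s l :
  0 < c -> (forall k, (k < l)%N -> W k.+1 \is hermsymmx) -> W 0%N = X0 ->
  dominated U X0 (c *: wgm a b sg) -> dominated U X1 (c *: wgm a b tau) ->
  (forall k, (k < l)%N -> block_nonneg (if bit s k then X1 else X0) (W k.+1) (W k)) ->
  dominated U (W l) (c *: wgm a b ((1 - dyadic R s l) * sg + dyadic R s l * tau)).
Proof.
move=> c0 hW W0 d0 d1; elim: l hW => [|l IH] hW hB.
  by rewrite W0 dyadic0 subr0 mul1r mul0r addr0.
have {IH}dW := IH (fun k kl => hW k (ltnW kl)) (fun k kl => hB k (ltnW kl)).
have {hB}B := hB l (ltnSn l).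
pose x := if bit s l then tau else sg.
have scE th i : (c *: wgm a b th : 'rV[R[i]]_N) 0 i = c * wgm a b th 0 i by rewrite mxE.
have pos th i : 0 < (c *: wgm a b th : 'rV[R[i]]_N) 0 i by rewrite scE mulr_gt0 // wgm_gt0.
apply: (block_dominated Uu (hW l (ltnSn l)) (pos x) (pos _) _ _ dW B); last first.
  by rewrite /x; case: ifP.
move=> i; rewrite !scE exprMn.
rewrite (@wgm_sqr _ _ _ _ x ((1 - dyadic R s l) * sg + dyadic R s l * tau)) //; first by ring.
have -> : dyadic R s l.+1 = ((bit s l)%:R + dyadic R s l) / 2.
  by rewrite -dyadicS -mulr_natr; field.
by rewrite -mulr_natr /x; case: (bit s l); rewrite /=; field.
Qed.

End Chain.

(* The triple (i, j, k) stands for the block [[E i, E j], [E j, E k]] >= 0.  The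
   matrices of the header are A at index x, B at index y, W_k at 2 + k (W_0 = Z), and
   V_k at l + 2 + k for 0 < k <= l (V_0 = A). *)
Definition mean_constraints (x y l s p : nat) : seq (nat * nat * nat) :=
  [seq ((if bit s k then x else 2), 3 + k, 2 + k)%N | k <- iota 0 l] ++
  (y, 2, 2 + l)%N ::
  [seq ((if bit p k then 2 else x), l + 3 + k, if k == 0%N then x else l + 2 + k)%N
     | k <- iota 0 l].

Definition mean_output (x l : nat) : nat := if l == 0%N then x else (l + 2 + l)%N.

Definition satisfies (C : numClosedFieldType) N (E : nat -> 'M[C]_N)
    (cs : seq (nat * nat * nat)) :=
  {in cs, forall c, block_nonneg (E c.1.1) (E c.1.2) (E c.2)}.

(** * Soundness and completeness of the constraints for the mean with weight p/q *)

Section Mean.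
Context {R : realType} (N : nat).
Variables (U : 'M[R[i]]_N) (a b : 'rV[R]_N).
Hypotheses (a0 : forall i, 0 < a 0 i) (b0 : forall i, 0 < b 0 i).
Variables (l q p : nat).
Hypotheses (lq : (2 ^ l <= q)%N) (ql : (q < 2 ^ l.+1)%N) (pl : (p < 2 ^ l)%N).

Let s := (q - 2 ^ l)%N.
Let th : R := 2 ^+ l / q%:R.

Let q0 : q%:R != 0 :> R.
Proof. by rewrite pnatr_eq0 -lt0n (leq_trans _ lq) // expn_gt0. Qed.

(** The equation of the loop: the exponent of Z is the average of 1, for [E y], and of the exponent
    of W_l. It holds because [dyadic R s l] is q/2^l - 1. *)
Let th_double : th *+ 2 = 1 + (1 - dyadic R s l) * th.
Proof.
have sl : (s < 2 ^ l)%N by rewrite /s; move: ql; rewrite expnS; lia.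
have l0 : 2 ^+ l != 0 :> R by rewrite expf_neq0 // pnatr_eq0.
rewrite dyadic_small // /s natrB // natrX /th mulr2n.
by move: (2 ^+ l) l0 (q%:R) q0 => d d0 r r0; field; apply/andP.
Qed.

Let pq : dyadic R p l * th = p%:R / q%:R.
Proof.
  rewrite dyadic_small // /th.
  have : 2 ^+ l != 0 :> R by rewrite expf_neq0 // pnatr_eq0.
  by move: (2 ^+ l) (q%:R) q0 => d r r0 d0; field; apply/andP.
Qed.

Lemma mean_sound (E : nat -> 'M[R[i]]_N) x y :
  U \is unitarymx ->
  (forall j, (1 < j)%N -> E j \is hermsymmx) ->
  dominated U (E x) (wgm a b 0) -> dominated U (E y) (wgm a b 1) ->
  satisfies E (mean_constraints x y l s p) ->
  dominated U (E (mean_output x l)) (wgm a b (p%:R / q%:R)).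
Proof.
move=> Uu hE dx dy hS.
have S1 k : (k < l)%N -> block_nonneg (E (if bit s k then x else 2)%N) (E (3 + k)%N) (E (2 + k)%N).
  move=> kl; apply: (hS (_, _, _)); rewrite mem_cat; apply/orP; left.
  by apply/mapP; exists k; rewrite ?mem_iota.
have S2 : block_nonneg (E y) (E 2%N) (E (2 + l)%N).
  by apply: (hS (_, _, _)); rewrite mem_cat inE eqxx orbT.
have S3 k : (k < l)%N -> block_nonneg (E (if bit p k then 2 else x)%N) (E (l + 3 + k)%N)
    (E (if k == 0 then x else l + 2 + k)%N).
  move=> kl; apply: (hS (_, _, _)); rewrite mem_cat inE; apply/orP; right; apply/orP; right.
  by apply/mapP; exists k; rewrite ?mem_iota.
have dZ : dominated U (E 2%N) (wgm a b th).
  apply: (dominated_fixpoint Uu (hE 2%N isT)) => [i|c c1 dZ]; first exact: wgm_gt0.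
  have c0 : 0 < c by apply: lt_le_trans c1.
  (* Because c >= 1, the bound on [E x] may be weakened by c^2, so that both ends of the chain carry
     the same factor. *)
  have dx' : dominated U (E x) (c ^+ 2 *: wgm a b 0).
    apply: dominatedW dx => i; rewrite [leRHS]mxE ler_peMl ?exprn_ege1 // ltW //.
    exact: wgm_gt0.
  have dW : dominated U (E (2 + l)%N)
      (c ^+ 2 *: wgm a b ((1 - dyadic R s l) * th + dyadic R s l * 0)).
    apply: (@chain_dominated _ _ U a b Uu a0 b0 (E 2%N) (E x) (fun k => E (2 + k)%N) _ _ _ _ _
      (exprn_gt0 _ c0) _ erefl dZ dx') => k kl; first exact: hE.
    by have := S1 k kl; case: (bit s k).
  have pos t i : 0 < (c *: wgm a b t : 'rV[R[i]]_N) 0 i by rewrite mxE mulr_gt0 // wgm_gt0.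
  (* Closing the loop: [E y] carries the factor 1 and W_l the factor c^2, so their mean Z gets only
     c. *)
  apply: (block_dominated Uu (hE 2%N _) _ (pos th) _ dy dW S2) => // i.
    exact: wgm_gt0.
  rewrite mulr0 addr0 ![(_ *: _ : 'rV[R[i]]_N) 0 i]mxE exprMn [RHS]mulrCA.
  by rewrite (wgm_sqr _ a0 b0 th_double).
have hW k : (k < l)%N -> E (l + 2 + k.+1)%N \is hermsymmx by move=> _; apply: hE; lia.
(* The second chain runs from exponent 0 towards [th] along the digits of p, and ends at (p/2^l)
   (2^l/q) = p/q. *)
have := @chain_dominated _ _ U a b Uu a0 b0 (E x) (E 2%N)
  (fun k => E (if k == 0 then x else l + 2 + k)%N) 1 0 th p l ltr01 hW erefl.
rewrite !scale1r mulr0 add0r pq => H; apply: (H dx dZ) => k kl /=.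
by have := S3 k kl; rewrite (_ : l + 3 + k = l + 2 + k.+1)%N; [case: (bit p k)|lia].
Qed.

(* The weight of E y in E j, as a geometric mean of E x and E y, when every block is
   tight; only used for j > 1. *)
Definition mean_exponent (j : nat) : R :=
  if (j <= l + 2)%N then (1 - dyadic R s (j - 2)) * th else dyadic R p (j - (l + 2)) * th.

Definition mean_witness (j : nat) : 'M[R[i]]_N :=
  U *m diag_mx (wgm a b (mean_exponent j)) *m U ^t*.

Lemma mean_witness_herm j : mean_witness j \is hermsymmx.
Proof.
apply/hermmxP; rewrite /mean_witness !adjmxM adjmxK mulmxA tr_diag_mx map_diag_mx.
congr (_ *m diag_mx _ *m _); apply/rowP => i; rewrite [LHS]mxE.
by apply: geC0_conj; rewrite ltW // wgm_gt0.
Qed.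

(** With all lifting variables diagonal in the basis U, a block holds as soon as the exponent of its
    corner is the average of those on its diagonal. That is [dyadicS] along the chains and
    [th_double] at the loop. *)
Lemma mean_complete (E : nat -> 'M[R[i]]_N) x y :
  (forall u, hform (E x) u u = wsum (wgm a b 0) (u *m U)) ->
  (forall u, hform (E y) u u = wsum (wgm a b 1) (u *m U)) ->
  (forall j, (1 < j < (2 * l).+3)%N -> E j = mean_witness j) ->
  satisfies E (mean_constraints x y l s p) /\
  forall u, hform (E (mean_output x l)) u u = wsum (wgm a b (p%:R / q%:R)) (u *m U).
Proof.
move=> fx fy hE.
have fE j : (1 < j < (2 * l).+3)%N ->
    forall u, hform (E j) u u = wsum (wgm a b (mean_exponent j)) (u *m U).
  by move=> jl u; rewrite hE // /mean_witness hform_conj hform_diag.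
have block i j k e f : (1 < j < (2 * l).+3)%N -> mean_exponent j *+ 2 = e + f ->
    (forall u, hform (E i) u u = wsum (wgm a b e) (u *m U)) ->
    (forall u, hform (E k) u u = wsum (wgm a b f) (u *m U)) ->
    block_nonneg (E i) (E j) (E k).
  move=> jl ef fi fk; rewrite (hE j) //.
  have w0 t h : 0 < wgm a b t 0 h by exact: wgm_gt0.
  exact: (block_nonneg_diag (w0 e) (w0 _) (fun h => wgm_sqr h a0 b0 ef) fi fk).
have e2 : mean_exponent 2 = th.
  by rewrite /mean_exponent leq_addl subnn dyadic0 subr0 mul1r.
have half k s' : dyadic R s' k.+1 = ((bit s' k)%:R + dyadic R s' k) / 2.
  by rewrite -dyadicS -mulr_natr; field.
split.
  move=> c; rewrite mem_cat inE => /orP[/mapP[k]|/orP[/eqP->|/mapP[k]]].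
  - rewrite mem_iota add0n => /andP[_ kl] -> /=.
    apply: (block _ _ _ (if bit s k then 0 else th) ((1 - dyadic R s k) * th)).
    + lia.
    + rewrite /mean_exponent (_ : 3 + k <= l + 2)%N; last by lia.
      rewrite (_ : 3 + k - 2 = k.+1)%N; last by lia.
      by rewrite half -mulr_natr; case: (bit s k) => /=; field.
    + case: (bit s k) => u; first exact: fx.
      by rewrite fE ?e2 //; lia.
    + move=> u; rewrite fE; last lia.
      rewrite /mean_exponent (_ : 2 + k <= l + 2)%N; last by lia.
      by rewrite addKn.
  - rewrite /=; apply: (block _ _ _ 1 ((1 - dyadic R s l) * th)).
    + lia.
    + by rewrite e2.
    + exact: fy.
    + move=> u; rewrite fE; last lia.
      by rewrite /mean_exponent addnC leqnn addnK.
  - rewrite mem_iota add0n => /andP[_ kl] -> /=.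
    apply: (block _ _ _ (if bit p k then th else 0) (dyadic R p k * th)).
    + lia.
    + rewrite /mean_exponent (_ : l + 3 + k <= l + 2 = false)%N; last by lia.
      rewrite (_ : l + 3 + k - (l + 2) = k.+1)%N; last by lia.
      by rewrite half -mulr_natr; case: (bit p k) => /=; field.
    + case: (bit p k) => u; last exact: fx.
      by rewrite fE ?e2 //; lia.
    + case: eqP => [->|/eqP k0] u; first by rewrite dyadic0 mul0r.
      rewrite fE; last lia.
      rewrite /mean_exponent (_ : l + 2 + k <= l + 2 = false)%N; last by lia.
      by rewrite addKn.
(* For l = 0 the second chain is empty: the output is [E x] itself and the exponent is 0. *)
rewrite /mean_output -pq => u; case: eqP => [l0|/eqP l0].
  by rewrite fx l0 dyadic0 mul0r.
rewrite fE; last lia.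
rewrite /mean_exponent (_ : l + 2 + l <= l + 2 = false)%N; last by lia.
by rewrite addKn.
Qed.

End Mean.

(** * Left and right multiplication as operators on vectorized matrices *)

Section Kronecker.
Context {C : numClosedFieldType}.

Lemma sum_mxvec (n m : nat) (F : 'I_(n * m) -> C) :
  \sum_k F k = \sum_i \sum_j F (mxvec_index i j).
Proof.
rewrite pair_bigA /= (reindex (uncurry (@mxvec_index n m))) /=.
  by apply: eq_bigr => -[i j].
exact: curry_mxvec_bij.
Qed.

Lemma mxvec_adj (n m : nat) (X Y : 'M[C]_(n, m)) :
  (mxvec X *m (mxvec Y) ^t*) 0 0 = \tr (X *m Y ^t*).
Proof.
rewrite mxE sum_mxvec /mxtrace; apply: eq_bigr => i _; rewrite mxE; apply: eq_bigr => j _.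
by rewrite [((mxvec Y) ^t*) _ _]mxE [(mxvec Y)^T _ _]mxE !mxvecE !mxE.
Qed.

Lemma mx_form_inj (n : nat) (M M' : 'M[C]_n) :
  (forall u v : 'rV_n, (u *m M *m v ^t*) 0 0 = (u *m M' *m v ^t*) 0 0) -> M = M'.
Proof.
have entry (A : 'M[C]_n) i j :
    ((delta_mx 0 i : 'rV_n) *m A *m (delta_mx 0 j : 'rV_n) ^t*) 0 0 = A i j.
  by rewrite trmx_delta map_delta_mx -rowE -colE !mxE.
by move=> h; apply/matrixP => i j; rewrite -!entry h.
Qed.

(** Adjoints are found by comparing sesquilinear forms, which [mxvec_adj] turns into traces. *)
Lemma lin_mulmx_adj (n m : nat) (A : 'M[C]_n) :
  (lin_mulmx A : 'M[C]_(n * m)) ^t* = lin_mulmx (A ^t*).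
Proof.
rewrite -[RHS]adjmxK; congr (_ ^t*); apply: mx_form_inj => u v.
rewrite -[u]vec_mxK -[v]vec_mxK mul_vec_lin -mulmxA -adjmxM mul_vec_lin !mxvec_adj.
by rewrite adjmxM adjmxK /= mulmxA [RHS]mxtrace_mulC mulmxA.
Qed.

Lemma lin_mulmxr_adj (n m : nat) (B : 'M[C]_m) :
  (lin_mulmxr B : 'M[C]_(n * m)) ^t* = lin_mulmxr (B ^t*).
Proof.
rewrite -[RHS]adjmxK; congr (_ ^t*); apply: mx_form_inj => u v.
rewrite -[u]vec_mxK -[v]vec_mxK mul_vec_lin -mulmxA -adjmxM mul_vec_lin !mxvec_adj.
by rewrite adjmxM adjmxK /= mulmxA.
Qed.

Lemma lin_mulmx_unitary (n m : nat) (P : 'M[C]_n) :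
  P \is unitarymx -> (lin_mulmx P : 'M[C]_(n * m)) \is unitarymx.
Proof.
move=> Pu; apply/unitarymxP; rewrite lin_mulmx_adj; apply/row_matrixP => i.
rewrite !rowE mulmx1 mulmxA; move: (delta_mx _ _) => u.
by rewrite -[u]vec_mxK !mul_vec_lin /= mulmxA (mulmx1C (unitarymxP Pu)) mul1mx.
Qed.

Lemma lin_mulmxr_unitary (n m : nat) (Q : 'M[C]_m) :
  Q \is unitarymx -> (lin_mulmxr Q : 'M[C]_(n * m)) \is unitarymx.
Proof.
move=> Qu; apply/unitarymxP; rewrite lin_mulmxr_adj; apply/row_matrixP => i.
rewrite !rowE mulmx1 mulmxA; move: (delta_mx _ _) => u.
by rewrite -[u]vec_mxK !mul_vec_lin /= -mulmxA (unitarymxP Qu) mulmx1.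
Qed.

(** Sends the vectorization of X to that of P X Q^*, the coordinates of X in the product of two
    eigenbases. *)
Definition kron_basis (n m : nat) (P : 'M[C]_n) (Q : 'M[C]_m) : 'M[C]_(n * m) :=
  lin_mulmx P *m lin_mulmxr (Q ^t*).

Lemma kron_basis_unitary (n m : nat) (P : 'M[C]_n) (Q : 'M[C]_m) :
  P \is unitarymx -> Q \is unitarymx -> kron_basis P Q \is unitarymx.
Proof.
move=> Pu Qu; apply: mul_unitarymx; first exact: lin_mulmx_unitary.
by apply: lin_mulmxr_unitary; rewrite trmxC_unitary.
Qed.

(** With Y = P X Q^* the trace becomes tr (Y^* D Y E), the sum of d_i e_j |Y_ij|^2. *)
Lemma mxtrace_spectral (n m : nat) (P : 'M[C]_n) (Q : 'M[C]_m) (d : 'rV[C]_n)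
    (e : 'rV[C]_m) (X : 'M[C]_(n, m)) :
  \tr (X ^t* *m (P ^t* *m diag_mx d *m P) *m X *m (Q ^t* *m diag_mx e *m Q)) =
  wsum (mxvec (\matrix_(i, j) (d 0 i * e 0 j))) (mxvec X *m kron_basis P Q).
Proof.
pose Y := P *m X *m Q ^t*.
have -> : mxvec X *m kron_basis P Q = mxvec Y by rewrite mulmxA !mul_vec_lin.
transitivity (\tr (Y ^t* *m diag_mx d *m Y *m diag_mx e)).
  by rewrite /Y !adjmxM adjmxK !mulmxA mxtrace_mulC !mulmxA.
rewrite /wsum sum_mxvec exchange_big; apply: eq_bigr => j _.
rewrite !mul_mx_diag !mxE mulr_suml; apply: eq_bigr => i _.
by rewrite !mxvecE !mxE normCK; ring.
Qed.

End Kronecker.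

(** * Semidefinite blocks, LMIs from real-linear maps, Hermitian coordinates *)

Section Semidefinite.
Context {R : realType}.

Lemma possemidefP (n : nat) (M : 'M[R[i]]_n) :
  possemidefmx M <-> M \is hermsymmx /\ forall u, 0 <= hform M u u.
Proof.
split=> -[hM h]; split=> // u; first by have := h (u ^t*); rewrite adjmxK.
by have := h (u ^t*); rewrite /hform adjmxK.
Qed.

Lemma possemidef_block (n : nat) (X Z Y : 'M[R[i]]_n) :
  X \is hermsymmx -> Z \is hermsymmx -> Y \is hermsymmx ->
  possemidefmx (block_mx X Z Z Y) <-> block_nonneg X Z Y.
Proof.
move=> hX hZ hY.
have hB : block_mx X Z Z Y \is hermsymmx.
  apply/hermmxP; rewrite tr_block_mx map_block_mx.
  by rewrite (hermmxP _ hX) (hermmxP _ hY) (hermmxP _ hZ).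
have E u v : hform (block_mx X Z Z Y) (row_mx u v) (row_mx u v)
    = hform X u u + hform Z u v + hform Z v u + hform Y v v.
  rewrite /hform mul_row_block tr_row_mx map_col_mx mul_row_col !mulmxDl.
  rewrite mxE [X in X + _]mxE [X in _ + X]mxE.
  by rewrite addrACA addrA.
split=> [/possemidefP[_ h] u v|h]; first by rewrite -E.
by apply/possemidefP; split=> // u; rewrite -[u]hsubmxK E.
Qed.

Lemma possemidef_scalar (c : R[i]) : possemidefmx (c%:M : 'M_1) <-> 0 <= c.
Proof.
have E (u : 'rV[R[i]]_1) : hform c%:M u u = c * `|u 0 0| ^+ 2.
  by rewrite /hform mul_mx_scalar -scalemxAl mxE mxE big_ord1 !mxE normCK.
split=> [/possemidefP[_ h]|c0].
  by have := h (const_mx 1); rewrite E mxE normr1 expr1n mulr1.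
apply/possemidefP; split=> [|u]; last by rewrite E mulr_ge0 ?exprn_ge0.
by apply/hermmxP; rewrite tr_scalar_mx map_scalar_mx /= geC0_conj.
Qed.

Definition rlinear (k : nat) (V : lmodType R[i]) (f : 'rV[R]_k -> V) :=
  forall c u v, f (c *: u + v) = c%:C *: f u + f v.

Lemma rlinear0 k (V : lmodType R[i]) (f : 'rV[R]_k -> V) : rlinear f -> f 0 = 0.
Proof.
move=> h; have := h 1 0 0; rewrite scaler0 addr0 scale1r => /eqP.
by rewrite -subr_eq0 opprD addrA subrr sub0r oppr_eq0 => /eqP.
Qed.

Lemma rlinear_sum k (V : lmodType R[i]) (f : 'rV[R]_k -> V) y : rlinear f ->
  f y = \sum_(i < k) (y 0 i)%:C *: f (delta_mx 0 i).
Proof.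
move=> h; have fD : {morph f : u v / u + v}.
  by move=> u v; have := h 1 u v; rewrite !scale1r.
rewrite [y in LHS]row_sum_delta (big_morph f fD (rlinear0 h)).
by apply: eq_bigr => i _; rewrite -[_ *: delta_mx _ _]addr0 h (rlinear0 h) addr0.
Qed.

Lemma herm0 n : (0 : 'M[R[i]]_n) \is hermsymmx.
Proof. by apply/hermmxP; rewrite trmx0 map_mx0. Qed.

(** All constraints of the representation are homogeneous, hence the zero constant term. *)
Definition lmi_of k N (f : 'rV[R]_k -> 'M[R[i]]_N) (hf : forall y, f y \is hermsymmx) :
  lmi k := LMI (herm0 N) (fun i => hf (delta_mx 0 i)).

Lemma lmi_ofP k N (f : 'rV[R]_k -> 'M[R[i]]_N) (hf : forall y, f y \is hermsymmx) y :
  rlinear f -> lmi_holds (lmi_of hf) y <-> possemidefmx (f y).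
Proof. by move=> lf; rewrite /lmi_holds /= add0r -rlinear_sum. Qed.

(** Inverse of [herm_coord] on Hermitian matrices. Imaginary parts are stored below the diagonal,
    hence the sign change above it. *)
Definition herm_of_coord (n : nat) (y : 'rV[R]_(n * n)) : 'M[R[i]]_n :=
  let M := vec_mx y in
  \matrix_(i, j) (if (i < j)%N then M i j +i* (- M j i)
                  else if i == j then (M i i)%:C else M j i +i* M i j).

Lemma herm_of_coord_herm n y : @herm_of_coord n y \is hermsymmx.
Proof.
apply/hermmxP/matrixP => i j; rewrite !mxE [j == i]eq_sym.
case: (ltngtP i j) => [ij|ij|/val_inj ->].
- by rewrite -val_eqE /= ltn_eqF.
- rewrite -val_eqE /= gtn_eqF //; exact: conjcK (_ +i* _).
- by rewrite eqxx; exact: conjc_real.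
Qed.

Lemma herm_coordK n (A : 'M[R[i]]_n) : A \is hermsymmx ->
  herm_of_coord (herm_coord A) = A.
Proof.
move=> /hermmxP hA; apply/matrixP => i j.
have E i' j' : A i' j' = (A j' i')^* by rewrite -[in LHS]hA !mxE.
rewrite /herm_of_coord mxE /herm_coord mxvecK !mxE.
case: ltngtP => [ij|ij|/val_inj ->].
- by rewrite [in complex.Im _]E; case: (A i j) => x y /=; rewrite opprK.
- rewrite (_ : i == j = false); last by apply/eqP => e; rewrite e ltnn in ij.
  by rewrite [A j i]E; case: (A i j).
- rewrite eqxx leqnn; have := E j j; case: (A j j) => x y [] /eqP.
  by rewrite -addr_eq0 -mulr2n mulrn_eq0 /= => /eqP ->.
Qed.

Lemma herm_of_coord_rlinear n : rlinear (@herm_of_coord n).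
Proof.
move=> c u v; apply/matrixP => i j; rewrite !mxE.
by case: ifP => _; [|case: ifP => _]; apply/eqP; rewrite eq_complex /=;
  apply/andP; split; apply/eqP; ring.
Qed.

Lemma herm_coordP n (A B : 'M[R[i]]_n) (c d : R) :
  herm_coord (c%:C *: A + d%:C *: B) = c *: herm_coord A + d *: herm_coord B.
Proof.
rewrite /herm_coord -!linearZ -linearD /=; congr mxvec.
apply/matrixP => i j; rewrite !mxE; case: (A i j) (B i j) => [x y] [z w] /=.
by case: ifP => _; ring.
Qed.

End Semidefinite.

(** * Joint diagonalization of the trace function; convexity from LMIs *)

Section Joint.
Context {R : realType}.

Lemma mxpow_adj n (A : 'M[R[i]]_n) s : mxpow A s =
  (spectralmx A) ^t* *m
  diag_mx (map_mx (fun z : R[i] => (complex.Re z `^ s)%:C) (spectral_diag A)) *m spectralmx A.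
Proof. by rewrite /mxpow invmx_unitary // spectral_unitarymx. Qed.

Lemma mxpow0 n (A : 'M[R[i]]_n) : mxpow A 0 = 1%:M.
Proof.
rewrite mxpow_adj (_ : map_mx _ _ = const_mx 1 :> 'rV_n); last first.
  by apply/rowP => i; rewrite !mxE powRr0.
by rewrite diag_const_mx mulmx1 (mulmx1C (unitarymxP (spectral_unitarymx A))).
Qed.

Lemma posdef_spectralE n (A : 'M[R[i]]_n) : posdefmx A ->
  A = (spectralmx A) ^t* *m diag_mx (spectral_diag A) *m spectralmx A.
Proof.
move=> [hA _]; have /orthomx_spectralP : A \is normalmx.
  by apply/normalmxP; move/hermmxP: hA => ->.
by rewrite invmx_unitary // spectral_unitarymx.
Qed.

(** The eigenvalue is the value of the form at a row of the unitary [spectralmx A], which is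
    nonzero. *)
Lemma posdef_spectral_gt0 n (A : 'M[R[i]]_n) i : posdefmx A -> 0 < spectral_diag A 0 i.
Proof.
move=> pA; have PP := unitarymxP (spectral_unitarymx A).
set P := spectralmx A in PP *; set D := spectral_diag A.
have E : (row i P *m A *m (row i P) ^t*) 0 0 = D 0 i.
  transitivity ((P *m A *m P ^t*) i i).
    by rewrite -row_mul mxE [RHS]mxE; apply: eq_bigr => j _; rewrite !mxE.
  rewrite [A in P *m A](posdef_spectralE pA) !mulmxA PP mul1mx -mulmxA PP mulmx1.
  by rewrite !mxE eqxx.
rewrite -E; case: pA => _ h.
have := h ((row i P) ^t*); rewrite adjmxK; apply; apply/eqP => r0.
have /eqP[] : row i P != 0 by apply/row_unitary_neq0/unitarymxP.
by rewrite -[row i P]adjmxK r0 trmx0 map_mx0.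
Qed.

Lemma mxpow1 n (A : 'M[R[i]]_n) : posdefmx A -> mxpow A 1 = A.
Proof.
move=> pA; rewrite mxpow_adj; set d := map_mx _ (spectral_diag A).
suff -> : d = spectral_diag A by rewrite -posdef_spectralE.
apply/rowP => i; rewrite mxE; have d0 := posdef_spectral_gt0 i pA.
have r0 : (complex.Re (spectral_diag A 0 i))%:C = spectral_diag A 0 i.
  by apply: RRe_real; apply: gtr0_real.
by rewrite powRr1 // -ler0c r0 ltW.
Qed.

(** The factor [1%:M] stands for [mxpow B 0], so that the form is the trace function at t = 0; the
    next lemma treats t = 1. *)
Lemma hform_lin_mulmx n m (A : 'M[R[i]]_n) (X : 'M[R[i]]_(n, m)) :
  hform (lin_mulmx A) (mxvec X) (mxvec X) = \tr (X ^t* *m A *m X *m 1%:M).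
Proof. by rewrite /hform mul_vec_lin mxvec_adj /= mulmx1 mxtrace_mulC mulmxA. Qed.

Lemma hform_lin_mulmxr n m (B : 'M[R[i]]_m) (X : 'M[R[i]]_(n, m)) :
  hform (lin_mulmxr B) (mxvec X) (mxvec X) = \tr (X ^t* *m 1%:M *m X *m B).
Proof. by rewrite /hform mul_vec_lin mxvec_adj /= mulmx1 mxtrace_mulC mulmxA. Qed.

(** At the index (i, j), a is the i-th eigenvalue of A and b the j-th of B. The basis and both
    vectors serve all X and t at once. *)
Lemma lieb_joint_diag n m (A : 'M[R[i]]_n) (B : 'M[R[i]]_m) :
  posdefmx A -> posdefmx B ->
  exists (U : 'M[R[i]]_(n * m)) (a b : 'rV[R]_(n * m)),
  [/\ U \is unitarymx, forall i, 0 < a 0 i, forall i, 0 < b 0 i &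
      forall (X : 'M[R[i]]_(n, m)) t,
      \tr (X ^t* *m mxpow A (1 - t) *m X *m mxpow B t) = wsum (wgm a b t) (mxvec X *m U)].
Proof.
move=> pA pB.
pose d i := complex.Re (spectral_diag A 0 i).
pose e j := complex.Re (spectral_diag B 0 j).
have re (x : R[i]) : 0 < x -> 0 < complex.Re x by rewrite ltcE => /andP[].
exists (kron_basis (spectralmx A) (spectralmx B)).
exists (mxvec (\matrix_(i, j) d i)), (mxvec (\matrix_(i, j) e j)); split.
- by apply: kron_basis_unitary; exact: spectral_unitarymx.
- by move=> k; case/mxvec_indexP: k => i j; rewrite mxvecE mxE; apply/re/posdef_spectral_gt0.
- by move=> k; case/mxvec_indexP: k => i j; rewrite mxvecE mxE; apply/re/posdef_spectral_gt0.
move=> X t; rewrite !mxpow_adj mxtrace_spectral; congr wsum.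
by apply/rowP => k; case/mxvec_indexP: k => i j; rewrite !(mxvecE, mxE) rmorphM.
Qed.

(** Exchanging A and B replaces t by 1 - t, which is how the case of a large p is reduced to a small
    one. *)
Lemma lieb_joint_diag_swap n m (A : 'M[R[i]]_n) (B : 'M[R[i]]_m) (sw : bool) :
  posdefmx A -> posdefmx B ->
  exists (U : 'M[R[i]]_(n * m)) (a b : 'rV[R]_(n * m)),
  [/\ [/\ U \is unitarymx, forall i, 0 < a 0 i & forall i, 0 < b 0 i],
    forall u, hform (if sw then lin_mulmxr B else lin_mulmx A) u u = wsum (wgm a b 0) (u *m U),
    forall u, hform (if sw then lin_mulmx A else lin_mulmxr B) u u = wsum (wgm a b 1) (u *m U) &
    forall (X : 'M[R[i]]_(n, m)) t,
      \tr (X ^t* *m mxpow A (1 - t) *m X *m mxpow B t) =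
      wsum (wgm a b (if sw then 1 - t else t)) (mxvec X *m U)].
Proof.
move=> pA pB; have [U [a [b [Uu a0 b0 T]]]] := lieb_joint_diag pA pB.
have fA u : hform (lin_mulmx A) u u = wsum (wgm a b 0) (u *m U).
  by rewrite -[u]vec_mxK hform_lin_mulmx -T subr0 (mxpow1 pA) (mxpow0 B).
have fB u : hform (lin_mulmxr B) u u = wsum (wgm a b 1) (u *m U).
  by rewrite -[u]vec_mxK hform_lin_mulmxr -T subrr (mxpow1 pB) (mxpow0 A).
case: sw; last by exists U, a, b.
exists U, b, a; split; [by split|move=> u|move=> u|move=> X t]; rewrite wgmC.
- by rewrite subr0 -fB.
- by rewrite subrr -fA.
- by rewrite subKr T.
Qed.

Lemma possemidef_comb n (M M' : 'M[R[i]]_n) (c d : R) : 0 <= c -> 0 <= d ->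
  possemidefmx M -> possemidefmx M' -> possemidefmx (c%:C *: M + d%:C *: M').
Proof.
move=> c0 d0 [hM pM] [hM' pM']; split=> [|v].
  apply/hermmxP; rewrite linearD !linearZ map_mxD !map_mxZ /= (hermmxP _ hM) (hermmxP _ hM').
  by rewrite !geC0_conj // ler0c.
rewrite mulmxDr mulmxDl -!scalemxAr -!scalemxAl mxE [X in X + _]mxE [X in _ + X]mxE.
by rewrite addr_ge0 // mulr_ge0 // ler0c.
Qed.

Lemma posdef_comb n (M M' : 'M[R[i]]_n) (c : R) : 0 <= c -> c <= 1 ->
  posdefmx M -> posdefmx M' -> posdefmx (c%:C *: M + (1 - c)%:C *: M').
Proof.
move=> c0 c1 [hM pM] [hM' pM']; split=> [|v v0].
  apply/hermmxP; rewrite linearD !linearZ map_mxD !map_mxZ /= (hermmxP _ hM) (hermmxP _ hM').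
  by rewrite !geC0_conj // ler0c // subr_ge0.
rewrite mulmxDr mulmxDl -!scalemxAr -!scalemxAl mxE [X in X + _]mxE [X in _ + X]mxE.
(* Strict positivity comes from [M'] when c = 0 and from [M] when c > 0. *)
move: c0; rewrite le_eqVlt => /orP[/eqP <-|c0].
  by rewrite subr0 mul0r add0r mul1r pM'.
apply: ltr_wpDr; last by rewrite mulr_gt0 ?pM // (ltcR 0).
by apply: mulr_ge0; [rewrite ler0c subr_ge0|rewrite ltW // pM'].
Qed.

Lemma lmi_holds_comb k (L : lmi k) (y z : 'rV[R]_k) (c : R) : 0 <= c -> c <= 1 ->
  lmi_holds L y -> lmi_holds L z -> lmi_holds L (c *: y + (1 - c) *: z).
Proof.
rewrite /lmi_holds => c0 c1 hy hz.
have d0 : 0 <= 1 - c by rewrite subr_ge0.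
have := possemidef_comb c0 d0 hy hz; congr possemidefmx.
rewrite !scalerDr addrACA -scalerDl -rmorphD /= subrKC scale1r; congr (_ + _).
rewrite !scaler_sumr -big_split; apply: eq_bigr => i _ /=.
by rewrite !scalerA -scalerDl !mxE; congr (_ *: _); rewrite [RHS]rmorphD !rmorphM.
Qed.

(** A represented set is a projection of a convex one: lifting variables are combined with the same
    weights as the points, whose coordinates depend linearly on them. *)
Lemma lieb_convex_of_sdp n m (S : set (@lieb_space R n m)) r N :
  has_sdp_representation (@lieb_coord R n m) (@lieb_domain R n m) S r N -> lieb_convex S.
Proof.
move=> [s [l [L [_ _ rep]]]] x z c c0 c1 /rep[[Ax Bx] [y hy]] /rep[[Az Bz] [y' hy']].
apply/rep; split; first by split; apply: posdef_comb.
exists (c *: y + (1 - c) *: y') => i.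
rewrite (_ : row_mx _ _ = c *: row_mx (lieb_coord x) y + (1 - c) *: row_mx (lieb_coord z) y').
  exact: lmi_holds_comb.
rewrite /lieb_coord !scale_row_mx !add_row_mx !herm_coordP.
congr (row_mx (row_mx _ _) _).
by apply/matrixP => i' j'; rewrite !mxE.
Qed.

End Joint.

(** * The vector of all variables and the LMIs imposed on it *)

Section Lifting.
Context {R : realType} (n m V : nat).
Local Notation N := (n * m)%N.
Local Notation dim := (n * n + m * m + 1 + V.+1 * (N * N))%N.

(** Index 0 is X -> A X, index 1 is X -> X B, and the others are lifting matrices. Their number is a
    successor so that [inord] applies; out of range it returns 0, which still gives a Hermitian
    matrix. *)
Definition node (y : 'rV[R]_dim) (j : nat) : 'M[R[i]]_N :=
  match j with
  | 0 => lin_mulmx (herm_of_coord (lsubmx (lsubmx (lsubmx y))))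
  | 1 => lin_mulmxr (herm_of_coord (rsubmx (lsubmx (lsubmx y))))
  | j'.+2 => herm_of_coord (row (inord j') (vec_mx (rsubmx y)))
  end.

Lemma node_rlinear j : rlinear (node ^~ j).
Proof.
move=> c u v; case: j => [|[|j]]; rewrite /node !linearP /= herm_of_coord_rlinear //.
all: exact: linearP.
Qed.

Lemma node_herm y j : node y j \is hermsymmx.
Proof.
case: j => [|[|j]] /=; last exact: herm_of_coord_herm.
- by apply/hermmxP; rewrite lin_mulmx_adj (hermmxP _ (herm_of_coord_herm _)).
- by apply/hermmxP; rewrite lin_mulmxr_adj (hermmxP _ (herm_of_coord_herm _)).
Qed.

Definition block_lmi_form (c : nat * nat * nat) (y : 'rV[R]_dim) : 'M[R[i]]_(N + N) :=
  block_mx (node y c.1.1) (node y c.1.2) (node y c.1.2) (node y c.2).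

Lemma block_lmi_form_rlinear c : rlinear (block_lmi_form c).
Proof.
move=> d u v; rewrite /block_lmi_form !(node_rlinear _ d).
by rewrite scale_block_mx add_block_mx.
Qed.

Lemma block_lmi_form_herm c y : block_lmi_form c y \is hermsymmx.
Proof.
apply/hermmxP; rewrite tr_block_mx map_block_mx.
by rewrite !(hermmxP _ (node_herm _ _)).
Qed.

(** The scalar inequality on tau as a 1 x 1 LMI; tau is the last coordinate before the lifting
    variables. *)
Definition trace_lmi_form (K : 'M[R[i]]_(n, m)) (j : nat) (y : 'rV[R]_dim) : 'M[R[i]]_1 :=
  (hform (node y j) (mxvec K) (mxvec K) - (rsubmx (lsubmx y) 0 0)%:C)%:M.

Lemma trace_lmi_form_rlinear K j : rlinear (trace_lmi_form K j).
Proof.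
move=> d u v; rewrite /trace_lmi_form node_rlinear !linearP /= !mxE.
rewrite hformD hformZ.
rewrite scale_scalar_mx -raddfD; congr (_%:M).
by rewrite rmorphD rmorphM /=; ring.
Qed.

Lemma trace_lmi_form_herm K j y : trace_lmi_form K j y \is hermsymmx.
Proof.
apply/hermmxP; rewrite tr_scalar_mx map_scalar_mx; congr (_%:M).
rewrite rmorphB /= -hformC ?node_herm //; congr (_ - _).
exact: conjc_real.
Qed.

Lemma node0 (x : lieb_space n m) z : x.1.1 \is hermsymmx ->
  node (row_mx (lieb_coord x) z) 0 = lin_mulmx x.1.1.
Proof. by move=> h; rewrite /node !row_mxKl herm_coordK. Qed.

Lemma node1 (x : lieb_space n m) z : x.1.2 \is hermsymmx ->
  node (row_mx (lieb_coord x) z) 1 = lin_mulmxr x.1.2.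
Proof. by move=> h; rewrite /node !row_mxKl row_mxKr herm_coordK. Qed.

Lemma nodeSS (c : 'rV_(n * n + m * m + 1)) (F : nat -> 'M[R[i]]_N) j :
  (j < V.+1)%N -> F j.+2 \is hermsymmx ->
  node (row_mx c (mxvec (\matrix_(k < V.+1) herm_coord (F k.+2)))) j.+2 = F j.+2.
Proof. by move=> jV h; rewrite /node row_mxKr mxvecK rowK inordK // herm_coordK. Qed.

(** Index 0 carries the scalar inequality, and the lifted indices carry the blocks of [cs] in
    order. *)
Lemma constraint_lmis (K : 'M[R[i]]_(n, m)) (cs : seq (nat * nat * nat)) (o : nat) :
  exists L : 'I_(size cs).+1 -> lmi dim,
    (forall i, (lmi_size (L i) <= maxn 1 (N + N))%N) /\
    forall Y, (forall i, lmi_holds (L i) Y) <->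
      satisfies (node Y) cs /\
      (rsubmx (lsubmx Y) 0 0)%:C <= hform (node Y o) (mxvec K) (mxvec K).
Proof.
pose L (i : 'I_(size cs).+1) := if unlift ord0 i is Some j
  then lmi_of (block_lmi_form_herm (tnth (in_tuple cs) j))
  else lmi_of (trace_lmi_form_herm K o).
exists L; split=> [i|Y].
  by rewrite /L; case: unlift => [j|] /=; rewrite leq_max leqnn ?orbT.
have blockP c : possemidefmx (block_lmi_form c Y) <->
    block_nonneg (node Y c.1.1) (node Y c.1.2) (node Y c.2).
  by apply: possemidef_block; apply: node_herm.
split=> [h|[h1 h2] i].
  split=> [c /(tnthP (in_tuple cs))[j ->]|].
    apply/blockP; have := h (lift ord0 j); rewrite /L liftK.
    by move/lmi_ofP; apply; apply: block_lmi_form_rlinear.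
  rewrite -subr_ge0; apply/possemidef_scalar.
  have := h ord0; rewrite /L unlift_none.
  by move/lmi_ofP; apply; apply: trace_lmi_form_rlinear.
rewrite /L; case: unlift => [j|]; apply/lmi_ofP.
- exact: block_lmi_form_rlinear.
- by apply/blockP/h1/mem_tnth.
- exact: trace_lmi_form_rlinear.
- by apply/possemidef_scalar; rewrite subr_ge0.
Qed.

End Lifting.

(** * Assembly: reduction to a small numerator, count of the LMIs, and both inclusions *)

Arguments node : simpl never.

Theorem theorem2 (R : realType) (n m : nat) (n_gt0 : (0 < n)%N) (m_gt0 : (0 < m)%N)
    (K : 'M[R[i]]_(n, m)) (p : int) (q : nat) (q_gt0 : (0 < q)%N)
    (t : R) (t_def : t = p%:~R / q%:R) (t_ge0 : 0 <= t) (t_le1 : t <= 1) :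
  lieb_convex (lieb_hypograph K t) /\
  has_sdp_representation (@lieb_coord R n m) (@lieb_domain R n m)
    (lieb_hypograph K t) (2 * trunc_log 2 q + 3) (2 * n * m).
Proof.
suff rep : has_sdp_representation (@lieb_coord R n m) (@lieb_domain R n m)
    (lieb_hypograph K t) (2 * trunc_log 2 q + 3) (2 * n * m).
  by split=> //; exact: lieb_convex_of_sdp rep.
have qR : 0 < q%:R :> R by rewrite ltr0n.
have [P pP] : exists P, p = Posz P.
  case: p t_def => [P|P] tP; first by exists P.
  by move: t_ge0; rewrite tP ler_pdivlMr // mul0r NegzE mulrNz oppr_ge0 lern0.
subst p.
have Pq : (P <= q)%N by move: t_le1; rewrite t_def ler_pdivrMr // mul1r ler_nat.
set l := trunc_log 2 q.
have /andP[lq ql] : (2 ^ l <= q < 2 ^ l.+1)%N by exact: trunc_log_bounds.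
(* One of P and q - P is at most q/2 < 2^l; it becomes the numerator p'. *)
pose sw := (q < 2 * P)%N.
pose p' := if sw then (q - P)%N else P.
have pl : (p' < 2 ^ l)%N by move: ql; rewrite /p' /sw expnS; case: (ltnP q (2 * P)); lia.
have tE : (if sw then 1 - t else t) = p'%:R / q%:R.
  rewrite /p' t_def; case: (sw) => //; rewrite natrB // mulrBl divff ?gt_eqF //.
(* The booleans are read as the node indices 0 for A and 1 for B. *)
pose x : nat := sw; pose y : nat := ~~ sw.
pose cs := mean_constraints x y l (q - 2 ^ l) p'.
have size_cs : size cs = (2 * l).+1.
  by rewrite size_cat /= !size_map size_iota; lia.
have [L [sizeL LP]] := constraint_lmis (2 * l) K cs (mean_output x l).
exists (size cs).+1, ((2 * l).+1 * (n * m * (n * m)))%N, L; split.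
(* There are 2l + 1 blocks and one scalar inequality, 2l + 2 LMIs in all. *)
- by rewrite size_cs; lia.
(* Positivity of n and m makes room for the 1 x 1 LMI. *)
- move=> i; apply: leq_trans (sizeL i) _; rewrite geq_max !muln_gt0 n_gt0 m_gt0 /=; lia.
case=> [[A B] tau].
have tauE z : rsubmx (lsubmx (row_mx (lieb_coord (A, B, tau)) z)) 0 0 = tau.
  by rewrite row_mxKl row_mxKr mxE.
have nodes z : posdefmx A -> posdefmx B ->
    node (row_mx (lieb_coord (A, B, tau)) z) x = (if sw then lin_mulmxr B else lin_mulmx A) /\
    node (row_mx (lieb_coord (A, B, tau)) z) y = (if sw then lin_mulmx A else lin_mulmxr B).
  by move=> [hA _] [hB _]; rewrite /x /y; case: (sw) => /=; rewrite node0 // node1.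
split=> [[pA pB hT]|[[/= pA pB] [z /LP[hS hT]]]].
  have [U [a [b [[Uu a0 b0] fx fy hK]]]] := lieb_joint_diag_swap sw pA pB.
  split; first by split.
  (* The lifting variables are the tight means at the indices 2 to 2l + 2, for which the output form
     at K equals the trace. *)
  pose F := mean_witness U a b l q p'.
  pose z := mxvec (\matrix_(k < (2 * l).+1) herm_coord (F k.+2)).
  exists z; apply/LP; have [nx ny] := nodes _ z pA pB; set Y := row_mx _ z.
  have hF j : F j \is hermsymmx by apply: mean_witness_herm.
  have [||j /andP[j1 j2]|S out] := @mean_complete R _ U a b a0 b0 l q p' lq ql pl (node Y) x y.
  - by move=> u; rewrite nx.
  - by move=> u; rewrite ny.
  - by case: j j1 j2 => [|[|j]] // _ j2; rewrite /Y nodeSS.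
  split=> //; rewrite out tauE -tE -hK; exact: hT.
have [U [a [b [[Uu a0 b0] fx fy hK]]]] := lieb_joint_diag_swap sw pA pB.
have [nx ny] := nodes _ z pA pB.
split=> //; rewrite hK tE; move: hT; rewrite tauE => /le_trans; apply.
apply: (mean_sound a0 b0 lq ql pl Uu _ _ _ hS) => [j _|u|u].
- exact: node_herm.
- by rewrite nx fx.
- by rewrite ny fy.
Qed.
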